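(* Let $1 \leq p < \infty$, let $E$ be a Banach lattice such that either $E^*$ has cotype $p$ or $E$ has the disjoint property of order $p$, and let $X$ be a Banach space. Then a linear operator $T\colon E \to X$ is disjoint $p$-convergent if and only if $T$ is almost Dunford-Pettis.
   Context: All linear operators are assumed bounded. A sequence $(x_n)_n$ in a Banach lattice is disjoint if $|x_n|\wedge|x_m|=0$ for $n\neq m$. A sequence $(x_n)_n$ in a Banach space $Z$ is weakly $p$-summable if $(x^*(x_n))_n \in \ell_p$ for every $x^* \in Z^*$. A linear operator from a Banach lattice to a Banach space is disjoint $p$-convergent if it sends disjoint weakly $p$-summable sequences to norm null sequences; it is almost Dunford-Pettis if it sends disjoint weakly null sequences to norm null sequences. A Banach lattice $E$ has the disjoint property of order $p$ if each norm bounded disjoint sequence in $E$ is weakly $p$-summable. For $2 \le p < \infty$, a Banach space $Z$ has cotype $p$ if there is a constant $C>0$ such that $\left(\sum_{k=1}^n \|x_k\|^p\right)^{1/p} \leq C \left(\int_0^1 \left\|\sum_{k=1}^n r_k(t)x_k\right\|^2 dt\right)^{1/2}$ for every finite subset $\{x_1,\dots,x_n\}\subseteq Z$, where $(r_k)_k$ is the Rademacher sequence (so the hypothesis ''$E^*$ has cotype $p$'' is only meaningful for $p \geq 2$). *)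

(* Defs.v *)
From HB Require Import structures.
From mathcomp Require Import all_boot all_order all_algebra.
From mathcomp Require Import all_classical all_reals all_analysis.

Set Implicit Arguments.
Unset Strict Implicit.
Unset Printing Implicit Defensive.

Import Order.TTheory GRing.Theory Num.Theory.
Import numFieldNormedType.Exports.

Local Open Scope classical_set_scope.
Local Open Scope ring_scope.

(* The order is a field of the mixin rather than an inherited Order.Lattice:
   HB refuses a new structure joining Order.Lattice and GRing.Zmodule, because
   Num.RealDomain would have had to inherit from it. [`|x|] is the norm; the lattice modulus is
   [lat_join x (- x)]. *)
HB.mixin Record isBanachLattice (R : realType) E
    of CompleteNormedModule R E := {
  lat_le : rel E ;
  lat_meet : E -> E -> E ;
  lat_join : E -> E -> E ;
  lat_le_refl : reflexive lat_le ;
  lat_le_anti : antisymmetric lat_le ;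
  lat_le_trans : transitive lat_le ;
  lat_le_meet : forall x y z,
    lat_le z (lat_meet x y) = lat_le z x && lat_le z y ;
  lat_le_join : forall x y z,
    lat_le (lat_join x y) z = lat_le x z && lat_le y z ;
  lat_leD2r : forall z x y, lat_le x y -> lat_le (x + z) (y + z) ;
  lat_leZ2l : forall (a : R) x y,
    0 <= a -> lat_le x y -> lat_le (a *: x) (a *: y) ;
  lat_le_norm : forall x y,
    lat_le (lat_join x (- x)) (lat_join y (- y)) -> `|x| <= `|y|
}.

#[short(type="banachLatticeType")]
HB.structure Definition BanachLattice (R : realType) :=
  { E of CompleteNormedModule R E & isBanachLattice R E }.

Definition modulus {R : realType} {E : banachLatticeType R} (x : E) : E :=
  lat_join x (- x).

Section dual.
Context {R : realType} {E : normedModType R}.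

Definition dual_pred : {pred E -> R} :=
  mem [set f : E -> R | linear f /\ continuous f].

Record dual := Dual { dual_fun :> E -> R ; dualP : dual_fun \in dual_pred }.

HB.instance Definition _ := [isSub for dual_fun].
HB.instance Definition _ := [Choice of dual by <:].

Fact dual_submod_closed : submod_closed dual_pred.
Proof.
split=> [|a f g].
  rewrite inE; split; last by move=> x; exact: cvg_cst.
  by move=> a u v; rewrite /= scaler0 addr0.
rewrite !inE => -[lf cf] [lg cg]; split.
  move=> b u v; rewrite !fctE lf lg !scalerDr !scalerA (mulrC a b).
  by rewrite -!addrA; congr (_ + _); rewrite addrCA.
move=> x; apply: continuousD; last exact: cg.
by apply: continuousZl_tmp; exact: cf.
Qed.

HB.instance Definition _ :=
  GRing.isSubmodClosed.Build _ _ dual_pred dual_submod_closed.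
HB.instance Definition _ := [SubChoice_isSubLmodule of dual by <:].

Lemma dual_linear (f : dual) : linear f.
Proof. by have := dualP f; rewrite inE => -[]. Qed.

Lemma dual_continuous (f : dual) : continuous f.
Proof. by have := dualP f; rewrite inE => -[]. Qed.

HB.instance Definition _ (f : dual) :=
  GRing.isLinear.Build R E R *:%R f (dual_linear f).

Definition dual_norm (f : dual) : R :=
  sup [set `|f x| | x in [set x : E | `|x| <= 1]].

Lemma dual_norm_has_sup (f : dual) :
  has_sup [set `|f x| | x in [set x : E | `|x| <= 1]].
Proof.
split; first by exists `|f 0|, 0 => //=; rewrite normr0.
have /linear_bounded_continuous/bounded_funP/(_ 1)[M fM] := @dual_continuous f.
by exists M => _ [x /= x1 <-]; exact: fM.
Qed.

Lemma dual_norm_ub (f : dual) (x : E) : `|x| <= 1 -> `|f x| <= dual_norm f.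
Proof.
by move=> x1; apply: ub_le_sup; [exact: (dual_norm_has_sup f).2|exists x].
Qed.

Lemma dual_norm_le (f : dual) (M : R) :
  (forall x : E, `|x| <= 1 -> `|f x| <= M) -> dual_norm f <= M.
Proof.
move=> fM; apply: ge_sup; first exact: (dual_norm_has_sup f).1.
by move=> _ [x /= x1 <-]; exact: fM.
Qed.

Fact ler_dual_normD (f g : dual) :
  dual_norm (f + g) <= dual_norm f + dual_norm g.
Proof.
apply: dual_norm_le => x x1.
by rewrite (le_trans (ler_normD _ _))// lerD// dual_norm_ub.
Qed.

Fact dual_normZ_le (l : R) (f : dual) : dual_norm (l *: f) <= `|l| * dual_norm f.
Proof.
by apply: dual_norm_le => x x1; rewrite normrM ler_wpM2l// dual_norm_ub.
Qed.

Fact dual_normZ (l : R) (f : dual) : dual_norm (l *: f) = `|l| * dual_norm f.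
Proof.
apply/eqP; rewrite eq_le dual_normZ_le/=.
have [->|l0] := eqVneq l 0.
  rewrite normr0 mul0r (le_trans (normr_ge0 ((0 *: f) 0)))//.
  by rewrite dual_norm_ub// normr0.
rewrite -ler_pdivlMl ?normr_gt0// -normfV.
by rewrite -[leLHS](_ : dual_norm (l^-1 *: (l *: f)) = _) ?dual_normZ_le//
  scalerA mulVf// scale1r.
Qed.

Fact dual_norm0_eq0 (f : dual) : dual_norm f = 0 -> f = 0.
Proof.
move=> f0; apply/val_inj/funext => x /=.
have [->|x0] := eqVneq x 0; first exact: linear0.
have : `|f (`|x|^-1 *: x)| <= 0.
  by rewrite -f0 dual_norm_ub// normrZ normfV normr_id mulVf ?normr_eq0.
rewrite linearZ/= normr_le0 scaler_eq0 invr_eq0 normr_eq0 (negbTE x0)/=.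
by move/eqP.
Qed.

HB.instance Definition _ :=
  Lmodule_isNormed.Build R dual ler_dual_normD dual_normZ dual_norm0_eq0.

End dual.
Arguments dual {R} E.

Section notions.
Context {R : realType}.

(* The Rademacher sequence is (rademacher k) for k >= 1, hence [k.+1] below. *)
Definition rademacher (k : nat) (t : R) : R := Num.sg (sin (2 ^+ k * pi * t)).

Definition cotype (p : R) (Z : normedModType R) : Prop :=
  2 <= p /\
  exists2 C : R, 0 < C &
    forall (n : nat) (x : 'I_n -> Z),
      (\sum_(k < n) `|x k| `^ p) `^ p^-1 <=
      C * (\int[lebesgue_measure]_(t in `[0, 1])
             (`|\sum_(k < n) rademacher k.+1 t *: x k| ^+ 2)) `^ 2^-1.

Definition weakly_p_summable (p : R) (Z : normedModType R) (x : nat -> Z) :=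
  forall f : dual Z, cvgn (series (fun n => `|f (x n)| `^ p)).

Definition weakly_null (Z : normedModType R) (x : nat -> Z) :=
  forall f : dual Z, f (x n) @[n --> \oo] --> (0 : R).

Definition norm_null (Z : normedModType R) (x : nat -> Z) :=
  `|x n| @[n --> \oo] --> (0 : R).

Definition norm_bounded (Z : normedModType R) (x : nat -> Z) :=
  exists M : R, forall n, `|x n| <= M.

Context {E : banachLatticeType R}.

Definition disjoint_seq (x : nat -> E) :=
  forall n m, n != m -> lat_meet (modulus (x n)) (modulus (x m)) = 0.

Definition disjoint_p_convergent (p : R) (X : normedModType R) (T : E -> X) :=
  forall x : nat -> E, disjoint_seq x -> weakly_p_summable p x ->
    norm_null (T \o x).

Definition almost_Dunford_Pettis (X : normedModType R) (T : E -> X) :=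
  forall x : nat -> E, disjoint_seq x -> weakly_null x -> norm_null (T \o x).

End notions.

Definition disjoint_property {R : realType} (p : R) (E : banachLatticeType R) :=
  forall x : nat -> E, norm_bounded x -> disjoint_seq x -> weakly_p_summable p x.

(* Main.v *)
Require Import Defs.
From HB Require Import structures.
From mathcomp Require Import all_boot all_order all_algebra.
From mathcomp Require Import all_classical all_reals all_analysis.
From mathcomp Require Import lra.

(** A weakly p-summable sequence is weakly null because the terms of a
    convergent series tend to 0, so an almost Dunford-Pettis operator is disjoint
    p-convergent.  For the converse it is enough that every disjoint weakly null
    sequence be weakly p-summable.  Weakly null sequences are norm bounded
    ([weakly_null_bounded]: Banach-Steinhaus on the dual E', which is complete),
    so the disjoint property of order p gives the result, and the remaining
    point is that E has this property as soon as E' has cotype p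
    ([dual_cotype_disjoint_property]).

    Let x be disjoint with |x_k| <= M, let f be a functional and n a length.  The
    idea is to cut f into functionals g_0, ..., g_(n-1), with g_k carried by x_k,
    in such a way that
      g_k(x_k) = f(x_k)   and   | sum_k e_k g_k | <= |f|  whenever all |e_k| <= 1
    ([disjoint_functional_split]).  Applied to e_k = r_k(t), the second
    property bounds the Rademacher average in the definition of cotype by |f|, so
      sum_k |f(x_k)|^p <= M^p sum_k |g_k|^p <= (M C |f|)^p
    independently of n, and the series converges.

    A textbook would take for g_k the part of f in the band dual to x_k, which
    requires the order structure of E'.  The Hahn-Banach theorem on E^n gives
    the g_k at once.  On E^n, consider the sublinear functional
      q(y) = |f| * norm of (|y_0| \/ ... \/ |y_(n-1)|).
    On the vectors (a_0 x_0, ..., a_(n-1) x_(n-1)) the linear form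
    f(sum_k a_k x_k) is at most q, since by disjointness the modulus of
    sum_k a_k x_k lies below the supremum of the |a_k x_k|.  Let G be an
    extension dominated by q, and g_k its restriction to the k-th factor.  Then
    (sum_k e_k g_k)(v) = G(e_0 v, ..., e_(n-1) v), and the supremum of the
    |e_k v| is at most |v|, so this is at most |f| times the norm of v.

    The Hahn-Banach theorem is proved in the form of Mazur and Orlicz
    ([mazur_orlicz]), through minimal sublinear functionals. *)

Set Implicit Arguments.
Unset Strict Implicit.
Unset Printing Implicit Defensive.

Import Order.TTheory GRing.Theory Num.Theory.
Import numFieldNormedType.Exports.

Local Open Scope classical_set_scope.
Local Open Scope ring_scope.

(** * The Hahn-Banach theorem, in the form of Mazur and Orlicz *)

Section mazur_orlicz.
Context {R : realType} {V : lmodType R}.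

(** Homogeneity is only required as an inequality, which is what one checks in
    practice; for [0 < a], applied to [a] and [a^-1], it gives back the equality. *)
Record sublinear (q : V -> R) : Prop := Sublinear {
  sublinearD : forall x y, q (x + y) <= q x + q y ;
  sublinearZ : forall a x, 0 <= a -> q (a *: x) <= a * q x }.

Lemma sublinear0 (q : V -> R) : sublinear q -> q 0 = 0.
Proof.
move=> sq; apply/eqP; rewrite eq_le; apply/andP; split.
  by have := @sublinearZ _ sq 0 0 (lexx 0); rewrite scale0r mul0r.
by have := sublinearD sq 0 0; rewrite addr0 -subr_ge0 addrK.
Qed.

Lemma sublinear_geN (q : V -> R) x : sublinear q -> - q (- x) <= q x.
Proof.
by move=> sq; have := sublinearD sq x (- x); rewrite subrr (sublinear0 sq); lra.
Qed.

(** A convex cone in [V * R] below the graph of [q].  As a relation between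
    vectors and values it can stand for a linear form on a subspace or for the
    values prescribed on a ray, and well-definedness never has to be checked. *)
Record dominated_cone (q : V -> R) (D : V -> R -> Prop) : Prop := DominatedCone {
  dominated_cone0 : D 0 0 ;
  dominated_coneD : forall y s z t, D y s -> D z t -> D (y + z) (s + t) ;
  dominated_coneZ : forall a y s, 0 < a -> D y s -> D (a *: y) (a * s) ;
  dominated_cone_le : forall y s, D y s -> s <= q y }.

Definition ray (q : V -> R) (x y : V) (s : R) : Prop :=
  exists2 t, 0 <= t & y = t *: x /\ s = t * q x.

Lemma dominated_cone_ray (q : V -> R) (x : V) :
  sublinear q -> dominated_cone q (ray q x).
Proof.
move=> sq; split.
- by exists 0; rewrite // scale0r mul0r.
- move=> _ _ _ _ [t t0 [-> ->]] [t' t'0 [-> ->]].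
  by exists (t + t'); rewrite ?addr_ge0// scalerDl mulrDl.
- move=> a _ _ a0 [t t0 [-> ->]].
  by exists (a * t); rewrite ?mulr_ge0 ?(ltW a0)// scalerA mulrA.
- move=> _ _ [t t0 [-> ->]].
  (* t q(x) <= q(t x) is homogeneity for the factor 1/t. *)
  move: t0; rewrite le_eqVlt => /predU1P[<-|t0].
    by rewrite scale0r mul0r (sublinear0 sq).
  have := @sublinearZ _ sq t^-1 (t *: x).
  by rewrite invr_ge0 (ltW t0) scalerA mulVf ?gt_eqF// scale1r
    ler_pdivlMl//; exact.
Qed.

Lemma mem_ray (q : V -> R) (x : V) : ray q x x (q x).
Proof. by exists 1; rewrite ?ler01// scale1r mul1r. Qed.

(** The functional is [q' x = inf { q (x + y) - s | D y s }], which is finite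
    because [s <= q y <= q (x + y) + q (- x)].  This one construction serves
    twice: with the cone of the Mazur-Orlicz theorem, to incorporate the data to
    be extended, and with a ray, to show that minimal sublinear functionals are
    linear. *)
Lemma sublinear_tilt (q : V -> R) (D : V -> R -> Prop) :
  sublinear q -> dominated_cone q D ->
  exists q' : V -> R, [/\ sublinear q', forall x, q' x <= q x &
    forall y s, D y s -> q' (- y) <= - s].
Proof.
move=> sq cD; pose A x := [set r | exists y s, D y s /\ r = q (x + y) - s].
have Alb x : lbound (A x) (- q (- x)).
  move=> _ [y [s [/(dominated_cone_le cD) sy ->]]].
  have := sublinearD sq (x + y) (- x); rewrite addrAC subrr add0r; lra.
have Ainf x : has_inf (A x).
  split; last by exists (- q (- x)); exact: Alb.
  by exists (q (x + 0) - 0), 0, 0; split => //; exact: (dominated_cone0 cD).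
have Ale x y s : D y s -> inf (A x) <= q (x + y) - s.
  by move=> Dys; apply: ge_inf; [exact: (Ainf x).2|exists y, s].
exists (fun x => inf (A x)); split.
- split=> [x y|a x].
    rewrite -lerBlDr; apply: lb_le_inf; first exact: (Ainf x).1.
    move=> _ [u [s [Du ->]]]; rewrite lerBlDr -lerBlDl.
    apply: lb_le_inf; first exact: (Ainf y).1.
    move=> _ [v [t [Dv ->]]]; rewrite lerBlDl.
    apply: (le_trans (Ale _ _ _ (dominated_coneD cD Du Dv))).
    by have := sublinearD sq (x + u) (y + v); rewrite addrACA; lra.
  rewrite le_eqVlt => /predU1P[<-|a0].
    rewrite scale0r mul0r (le_trans (Ale _ _ _ (dominated_cone0 cD)))//.
    by rewrite addr0 subr0 (sublinear0 sq).
  rewrite -ler_pdivrMl//; apply: lb_le_inf; first exact: (Ainf x).1.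
  move=> _ [u [s [Du ->]]]; rewrite ler_pdivrMl//.
  apply: (le_trans (Ale _ _ _ (dominated_coneZ cD a0 Du))).
  by rewrite -scalerDr mulrBr lerD2r (sublinearZ sq)// ltW.
- by move=> x; have := Ale x _ _ (dominated_cone0 cD); rewrite addr0 subr0.
- move=> y s Dys; have := Ale (- y) _ _ Dys.
  by rewrite addNr (sublinear0 sq) sub0r.
Qed.

(** Zorn's lemma applies because the pointwise infimum of a nonempty chain is
    again sublinear: [- q (- x)] bounds it from below, and of the two members of
    the chain used for [x] and for [y], the smaller serves for [x + y]. *)
Lemma exists_minimal_sublinear (q : V -> R) : sublinear q ->
  exists p : V -> R, [/\ sublinear p, forall x, p x <= q x &
    forall p', sublinear p' -> (forall x, p' x <= p x) -> p' = p].
Proof.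
move=> sq.
pose S := {p : V -> R | sublinear p /\ forall x, p x <= q x}.
pose le_S : rel S := fun p p' => `[< forall x, sval p' x <= sval p x >].
have [||||[p [sp pq]] pmin] := @Zorn S le_S.
- by move=> p; apply/asboolP.
- move=> p1 p2 p3 /asboolP p21 /asboolP p32; apply/asboolP => x.
  exact: le_trans (p32 x) (p21 x).
- move=> p1 p2 /asboolP p21 /asboolP p12; apply: eq_sig_hprop => /=.
    by move=> *; exact: Prop_irrelevance.
  by apply/funext => x; apply/eqP; rewrite eq_le p12 p21.
- move=> A Atot; have [->|/set0P[p0 Ap0]] := eqVneq A set0.
    by exists (exist _ q (conj sq (fun x => lexx (q x)))).
  pose I x := [set sval p x | p in A].
  have Ilb x : has_inf (I x).
    split; first by exists (sval p0 x), p0.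
    exists (- q (- x)) => _ [[p [sp pq]] _ <-] /=.
    by apply: le_trans (sublinear_geN x sp); rewrite lerN2.
  have Ile x p : A p -> inf (I x) <= sval p x.
    by move=> Ap; apply: ge_inf; [exact: (Ilb x).2|exists p].
  have sI : sublinear (fun x => inf (I x)).
    split=> [x y|a x a0].
      rewrite -lerBlDr; apply: lb_le_inf; first exact: (Ilb x).1.
      move=> _ [p1 Ap1 <-]; rewrite lerBlDr -lerBlDl.
      apply: lb_le_inf; first exact: (Ilb y).1.
      move=> _ [p2 Ap2 <-]; rewrite lerBlDl.
      have [/asboolP p12|/asboolP p21] := Atot _ _ Ap1 Ap2.
        apply: (le_trans (Ile _ _ Ap2)).
        by apply: (le_trans (sublinearD (svalP p2).1 x y)); rewrite lerD2r.
      apply: (le_trans (Ile _ _ Ap1)).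
      by apply: (le_trans (sublinearD (svalP p1).1 x y)); rewrite lerD2l.
    move: a0; rewrite le_eqVlt => /predU1P[<-|a0].
      rewrite scale0r mul0r (le_trans (Ile _ _ Ap0))//.
      by rewrite (sublinear0 (svalP p0).1).
    rewrite -ler_pdivrMl//; apply: lb_le_inf; first exact: (Ilb x).1.
    move=> _ [p Ap <-]; rewrite ler_pdivrMl//.
    by apply: (le_trans (Ile _ _ Ap)); apply: (sublinearZ (svalP p).1); exact: ltW.
  have Iq x : inf (I x) <= q x by apply: (le_trans (Ile _ _ Ap0)); exact: (svalP p0).2.
  exists (exist _ (fun x => inf (I x)) (conj sI Iq)) => p Ap.
  by apply/asboolP => x /=; exact: Ile.
exists p; split=> // p' sp' p'p.
have p'q x : p' x <= q x by exact: le_trans (pq x).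
by have /(congr1 sval) := pmin (exist _ p' (conj sp' p'q)) (asboolT p'p).
Qed.

(** Tilting [p] along the ray through [x] cannot make it smaller, hence
    [p (- x) <= - p x], so that [p] is odd; an odd sublinear functional is
    linear. *)
Lemma minimal_sublinear_linear (p : V -> R) : sublinear p ->
  (forall p', sublinear p' -> (forall x, p' x <= p x) -> p' = p) ->
  linear p.
Proof.
move=> sp pmin.
have pN x : p (- x) = - p x.
  apply/eqP; rewrite eq_le; apply/andP; split; last first.
    by have := sublinear_geN (- x) sp; rewrite opprK.
  have [p' [sp' p'p p'D]] := sublinear_tilt sp (dominated_cone_ray x sp).
  rewrite (pmin p' sp' p'p) in p'D.
  exact/p'D/mem_ray.
have pZ a x : 0 <= a -> p (a *: x) = a * p x.
  move=> a0; apply/eqP; rewrite eq_le (sublinearZ sp)//=.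
  by rewrite -lerN2 -pN -scalerN -mulrN -pN (sublinearZ sp).
move=> a x y.
have pD u v : p (u + v) = p u + p v.
  apply/eqP; rewrite eq_le (sublinearD sp)/=.
  by have := sublinearD sp (u + v) (- v); rewrite addrK pN lerBrDr.
rewrite pD; congr (_ + _); have [a0|a0] := leP 0 a; first exact: pZ.
by rewrite -[a]opprK scaleNr pN pZ ?oppr_ge0 ?ltW// scaleNr.
Qed.

(** The tilted functional [q'] satisfies [q' (- y) <= - s] on the cone, and so
    does any linear functional below it, such as a minimal one. *)
Theorem mazur_orlicz (q : V -> R) (D : V -> R -> Prop) :
  sublinear q -> dominated_cone q D ->
  exists f : V -> R, [/\ linear f, forall x, f x <= q x &
    forall y s, D y s -> s <= f y].
Proof.
move=> sq cD; have [q' [sq' q'q q'D]] := sublinear_tilt sq cD.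
have [f [sf fq' fmin]] := exists_minimal_sublinear sq'.
have lf := minimal_sublinear_linear sf fmin.
exists f; split=> // [x|y s Dys]; first exact: le_trans (q'q x).
rewrite -lerN2; apply: le_trans (q'D _ _ Dys); apply: le_trans (fq' _).
have := sublinearD sf y (- y); rewrite subrr (sublinear0 sf); lra.
Qed.

End mazur_orlicz.

(** * Functionals on a normed space *)

Section dual_space.
Context {R : realType} {E : normedModType R}.

Lemma ler_dual (f : dual E) (x : E) : `|f x| <= `|f| * `|x|.
Proof.
have [->|x0] := eqVneq x 0; first by rewrite linear0 !normr0 mulr0.
have /(dual_norm_ub f) : `|(`|x|^-1 *: x)| <= 1.
  by rewrite normrZ normfV normr_id mulVf ?normr_eq0.
by rewrite linearZ/= normrM normfV normr_id ler_pdivrMl ?normr_gt0// mulrC.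
Qed.

Lemma dual_norm_le_one_sided (h : dual E) (C : R) : 0 <= C ->
  (forall x, h x <= C * `|x|) -> `|h| <= C.
Proof.
move=> C0 hC; apply: dual_norm_le => x x1.
suff : `|h x| <= C * `|x| by move=> /le_trans; apply; rewrite ler_piMr.
by rewrite ler_norml hC andbT lerNl -linearN -(normrN x) hC.
Qed.

Lemma bounded_linear_dual (f : E -> R) (C : R) : linear f -> 0 <= C ->
  (forall x, f x <= C * `|x|) -> exists2 g : dual E, g =1 f & `|g| <= C.
Proof.
move=> lf C0 fC.
pose F : {linear E -> R} := HB.pack f (GRing.isLinear.Build _ _ _ _ f lf).
have absF x : `|F x| <= C * `|x|.
  by rewrite ler_norml fC andbT lerNl -linearN -(normrN x) fC.
have cf : continuous f.
  apply: (@bounded_linear_continuous _ _ _ F); apply/bounded_funP => r.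
  by exists (C * r) => x xr; apply: (le_trans (absF x)); rewrite ler_wpM2l.
have fP : f \in @dual_pred R E by rewrite inE.
by exists (Dual fP) => //; exact: dual_norm_le_one_sided.
Qed.

(** The norm is sublinear, and the linear functional below it that reaches the
    value of the norm at [x] is provided by the ray through [x]. *)
Lemma norming_functional (x : E) : exists2 f : dual E, `|f| <= 1 & f x = `|x|.
Proof.
have sn : sublinear (fun y : E => `|y|).
  split=> [|a y a0]; first exact: ler_normD.
  by rewrite normrZ ger0_norm.
have [f [lf fn fD]] := mazur_orlicz sn (dominated_cone_ray x sn).
have [|g gf g1] := bounded_linear_dual lf ler01; first by move=> y; rewrite mul1r.
by exists g => //; rewrite gf; apply/eqP; rewrite eq_le fn fD//; exact: mem_ray.
Qed.

End dual_space.

Section complete.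
Context {R : realType} {E : normedModType R}.

(** The limit is taken pointwise.  If most elements of the filter are within [e]
    of [f], then so is the pointwise limit, because
    [`|g x - f x| <= e * `|x|] passes to the limit in [g]; this gives at the same
    time that the limit is bounded and that the convergence is in norm. *)
Lemma dual_complete (F : set_system (dual E)) : ProperFilter F -> cauchy F ->
  cvg F.
Proof.
move=> FF /cauchyP cF.
have evalB (f g : dual E) x : `|f x - g x| <= `|f - g| * `|x|.
  exact: (ler_dual (f - g)).
have cauchy_eval x : cvg ((fun f : dual E => f x) @ F).
  apply/cauchy_cvgP/cauchyP => e e0.
  have [|f Ff] := cF (e / (`|x| + 1)).
    by rewrite divr_gt0// ltr_wpDl.
  exists (f x); suff : F [set g : dual E | ball (f x) e (g x)] by [].
  apply: filterS Ff => g; rewrite -!ball_normE /= => fg.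
  apply: (le_lt_trans (evalB f g x)).
  have : `|f - g| * (`|x| + 1) < e by rewrite -ltr_pdivlMr// ltr_wpDl.
  by apply: le_lt_trans; rewrite ler_wpM2l// lerDl.
pose h x : R := lim ((fun f : dual E => f x) @ F).
have h_close e f : 0 < e -> F (ball f e) -> forall x, `|h x - f x| <= e * `|x|.
  move=> e0 Ff x; apply/ler_addgt0Pr => d d0.
  near F => g.
  have hg : `|h x - g x| < d.
    by near: g; move/cvgr_dist_lt : (cauchy_eval x); exact.
  have gf : ball f e g by near: g.
  rewrite -(subrKA (g x)) (le_trans (ler_normD _ _))// [leRHS]addrC lerD ?(ltW hg)//.
  by rewrite distrC (le_trans (evalB f g x))// ler_wpM2r// ltW.
have lh : linear h.
  move=> a x y; apply: cvg_lim => //.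
  under eq_fun do rewrite linearP.
  by apply: cvgD; [apply: cvgZr|]; exact: cauchy_eval.
have [f1 Ff1] := cF 1 ltr01.
have [||g gh _] := @bounded_linear_dual _ _ h (`|f1| + 1) lh.
- by rewrite addr_ge0.
- move=> x; apply: (le_trans (ler_norm _)); rewrite -[h x](subrK (f1 x)) (le_trans (ler_normD _ _))//.
  by rewrite mulrDl addrC lerD// ?ler_dual// h_close.
apply/cvg_ex; exists g; apply/cvgrPdist_le => e e0.
have [f Ff] := cF _ (divr_gt0 e0 (ltr0Sn R 1)).
apply: filterS (Ff) => k; rewrite -ball_normE /= => fk.
rewrite [e]splitr -(subrKA f) (le_trans (ler_normD _ _))// lerD ?(ltW fk)//.
apply: dual_norm_le => x x1.
rewrite [X in `|X|](_ : _ = h x - f x); last by rewrite -gh.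
rewrite (le_trans (h_close _ _ _ Ff x)) ?divr_gt0//.
by rewrite ler_piMr// divr_ge0// ltW.
Unshelve. all: by end_near. Qed.

HB.instance Definition _ := Uniform_isComplete.Build (dual E) dual_complete.

(** Evaluations at the [x n] are pointwise bounded functionals on the complete
    space [dual E], hence uniformly bounded; norming functionals turn this into
    a bound for the norms. *)
Lemma weakly_null_bounded (x : nat -> E) : weakly_null x -> norm_bounded x.
Proof.
move=> x0.
pose J n : dual E -> R := fun f => f (x n).
have [|f|M JM] := @Banach_Steinhauss R (dual E) R [set J n | n in setT] _ _ 1.
- move=> _ [n _ <-]; split.
    move=> r; exists (r * `|x n|) => f fr.
    by apply: (le_trans (ler_dual _ _)); rewrite ler_wpM2r.
  by move=> a f g.
- have [M [_ fM]] := cvg_seq_bounded (cvgP _ (x0 f)).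
  exists (M + 1) => _ [n _ <-]; apply: fM => //.
  by rewrite ltrDl.
exists M => n; have [f f1 <-] := norming_functional (x n).
apply: (le_trans (ler_norm _)); exact: (JM (J n)).
Qed.

End complete.

(** * Disjointness in a Banach lattice *)

Arguments lat_leD2r {R s} z {x y} _.
Arguments lat_leZ2l {R s a x y} _ _.

Section lattice.
Context {R : realType} {E : banachLatticeType R}.
Implicit Types x y z u v w : E.

Local Notation "x <=| y" := (lat_le x y) (at level 70).

Lemma lat_leT y x z : x <=| y -> y <=| z -> x <=| z.
Proof. exact: lat_le_trans. Qed.

Lemma lat_joinP x y z : reflect (x <=| z /\ y <=| z) (lat_join x y <=| z).
Proof. by rewrite lat_le_join; exact: andP. Qed.

Lemma lat_meetP x y z : reflect (z <=| x /\ z <=| y) (z <=| lat_meet x y).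
Proof. by rewrite lat_le_meet; exact: andP. Qed.

Lemma lat_joinl x y : x <=| lat_join x y.
Proof. by have /lat_joinP[] := lat_le_refl (lat_join x y). Qed.

Lemma lat_joinr x y : y <=| lat_join x y.
Proof. by have /lat_joinP[] := lat_le_refl (lat_join x y). Qed.

Lemma lat_meetl x y : lat_meet x y <=| x.
Proof. by have /lat_meetP[] := lat_le_refl (lat_meet x y). Qed.

Lemma lat_meetr x y : lat_meet x y <=| y.
Proof. by have /lat_meetP[] := lat_le_refl (lat_meet x y). Qed.

Lemma lat_leD x y u v : x <=| y -> u <=| v -> x + u <=| y + v.
Proof.
move=> xy uv; apply: (lat_leT (lat_leD2r u xy)).
by rewrite ![y + _]addrC; exact: lat_leD2r.
Qed.

Lemma lat_subr_ge0 x y : (0 <=| y - x) = (x <=| y).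
Proof.
apply/idP/idP => [/(lat_leD2r x)|/(lat_leD2r (- x))]; first by rewrite add0r subrK.
by rewrite subrr.
Qed.

Lemma lat_leN2 x y : x <=| y -> - y <=| - x.
Proof. by rewrite -lat_subr_ge0 -[in X in _ -> X]lat_subr_ge0 opprK addrC. Qed.

Lemma modulusP x z : reflect (x <=| z /\ - x <=| z) (modulus x <=| z).
Proof. exact: lat_joinP. Qed.

Lemma lat_le_modulus x : x <=| modulus x. Proof. exact: lat_joinl. Qed.

Lemma lat_leN_modulus x : - x <=| modulus x. Proof. exact: lat_joinr. Qed.

(** Adding [x <= |x|] and [- x <= |x|] gives [0 <= 2 |x|]. *)
Lemma modulus_ge0 x : 0 <=| modulus x.
Proof.
have := lat_leD (lat_le_modulus x) (lat_leN_modulus x).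
rewrite subrr => /(lat_leZ2l (a := 2^-1)).
rewrite invr_ge0 ler0n => /(_ isT).
by rewrite scaler0 -mulr2n -[modulus x *+ 2]scaler_nat scalerA mulVf ?scale1r// pnatr_eq0.
Qed.

Lemma modulus_id u : 0 <=| u -> modulus u = u.
Proof.
move=> u0; apply: lat_le_anti; rewrite lat_le_modulus andbT.
apply/modulusP; split; first exact: lat_le_refl.
by apply: lat_leT (u0); have := lat_leN2 u0; rewrite oppr0.
Qed.

Lemma modulus_le_norm x u : modulus x <=| u -> `|x| <= `|u|.
Proof.
move=> xu; apply: lat_le_norm; rewrite -/(modulus x) -/(modulus u).
by apply: (lat_leT xu); exact: lat_le_modulus.
Qed.

Lemma modulusD x y : modulus (x + y) <=| modulus x + modulus y.
Proof.
apply/modulusP; split; first by apply: lat_leD; exact: lat_le_modulus.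
by rewrite opprD; apply: lat_leD; exact: lat_leN_modulus.
Qed.

Lemma modulusZ_le (a : R) x : modulus (a *: x) <=| `|a| *: modulus x.
Proof.
have pos (b : R) y : 0 <= b -> modulus (b *: y) <=| b *: modulus y.
  move=> b0; apply/modulusP; split; first exact: lat_leZ2l (lat_le_modulus y).
  by rewrite -scalerN; exact: lat_leZ2l (lat_leN_modulus y).
have modN y : modulus (- y) <=| modulus y.
  by apply/modulusP; rewrite opprK; split;
    [exact: lat_leN_modulus|exact: lat_le_modulus].
have [a0|a0] := leP 0 a; first by rewrite ger0_norm ?pos.
rewrite ltr0_norm// -[a *: x]opprK -scaleNr.
by apply: (lat_leT (modN _)); apply: pos; rewrite oppr_ge0 ltW.
Qed.

Lemma modulusZ (a : R) x : modulus (a *: x) = `|a| *: modulus x.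
Proof.
apply: lat_le_anti; rewrite modulusZ_le/=.
have [->|a0] := eqVneq a 0.
  by rewrite normr0 scale0r; exact: modulus_ge0.
have := lat_leZ2l (normr_ge0 a) (modulusZ_le a^-1 (a *: x)).
by rewrite !scalerA -normrM mulVf ?divff// normr1 !scale1r.
Qed.

(** For disjoint vectors the sum is the supremum: [u + v - w] lies below both
    [u] and [v], hence below their infimum 0. *)
Lemma disjoint_leD u v w : lat_meet u v = 0 -> u <=| w -> v <=| w ->
  u + v <=| w.
Proof.
move=> uv0 uw vw; suff : u + v - w <=| lat_meet u v.
  by rewrite uv0 => /(lat_leD2r w); rewrite subrK add0r.
have sub_le x y : x <=| w -> y + x - w <=| y.
  move=> xw; have := lat_leD2r (y - w) xw.
  by rewrite addrCA addrA [w + _]addrC subrK.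
by apply/lat_meetP; split; [|rewrite (addrC u)]; exact: sub_le.
Qed.

Lemma meet_eq0P u v : 0 <=| u -> 0 <=| v ->
  (forall z, z <=| u -> z <=| v -> z <=| 0) -> lat_meet u v = 0.
Proof.
move=> u0 v0 uv; apply: lat_le_anti; apply/andP; split; last exact/lat_meetP.
by apply: uv; [exact: lat_meetl|exact: lat_meetr].
Qed.

(** If [z] is below [u + w] and [v], then [z - w] is below [u] and [v], hence
    below 0; so [z] is below [w] and [v], hence below 0. *)
Lemma disjointDl u v w : 0 <=| u -> 0 <=| w -> 0 <=| v ->
  lat_meet u v = 0 -> lat_meet w v = 0 -> lat_meet (u + w) v = 0.
Proof.
move=> u0 w0 v0 uv wv; apply: meet_eq0P => //.
  by rewrite -[0]addr0; exact: lat_leD.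
move=> z zuw zv; rewrite -wv; apply/lat_meetP; split=> //.
suff : z - w <=| lat_meet u v.
  by rewrite uv => /(lat_leD2r w); rewrite subrK add0r.
apply/lat_meetP; split.
  by have := lat_leD2r (- w) zuw; rewrite addrK.
apply: lat_leT zv; have := lat_leD2r (z - w) w0.
by rewrite add0r [w + _]addrC subrK.
Qed.

(** With [c] any bound of [a] and [b], a common lower bound of [a *: u] and
    [b *: v] is [c] times a common lower bound of [u] and [v]. *)
Lemma disjointZ (a b : R) u v : 0 <= a -> 0 <= b -> 0 <=| u -> 0 <=| v ->
  lat_meet u v = 0 -> lat_meet (a *: u) (b *: v) = 0.
Proof.
move=> a0 b0 u0 v0 uv.
have Z_ge0 (c : R) x : 0 <= c -> 0 <=| x -> 0 <=| c *: x.
  by move=> c0 /(lat_leZ2l c0); rewrite scaler0.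
apply: meet_eq0P; rewrite ?Z_ge0// => z zu zv.
(* The summand 1 makes the bound invertible when a = b = 0. *)
have c0 : 0 < a + b + 1 by rewrite ltr_wpDl// addr_ge0.
suff : (a + b + 1)^-1 *: z <=| lat_meet u v.
  rewrite uv => /(lat_leZ2l (ltW c0)).
  by rewrite scaler0 scalerA divff ?gt_eqF// scale1r.
have shrink d x : 0 <= d -> d <= a + b + 1 -> 0 <=| x -> z <=| d *: x ->
    (a + b + 1)^-1 *: z <=| x.
  move=> d0 dc x0 zx.
  rewrite -[x](scalerK (lt0r_neq0 c0)).
  apply: lat_leZ2l; first by rewrite invr_ge0 ltW.
  apply: (lat_leT zx); rewrite -lat_subr_ge0 -scalerBl.
  by rewrite Z_ge0// subr_ge0.
by apply/lat_meetP; split; [apply: (shrink a)|apply: (shrink b)] => //; lra.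
Qed.

(** Finite form of [disjoint_leD]: partial sums stay disjoint from the next
    term. *)
Lemma disjoint_sum_le (I : eqType) (r : seq I) (u : I -> E) w :
  uniq r -> (forall i, 0 <=| u i) ->
  (forall i j, i != j -> lat_meet (u i) (u j) = 0) ->
  0 <=| w -> (forall i, u i <=| w) -> \sum_(i <- r) u i <=| w.
Proof.
move=> + u0 uD w0 uw; pose s r := \sum_(i <- r) u i.
have s_ge0 t : 0 <=| s t.
  apply: (big_ind (fun y => 0 <=| y)) => [|x y x0 y0|i _]; last exact: u0.
    exact: lat_le_refl.
  by rewrite -[0]addr0; exact: lat_leD.
have s_disj t j : j \notin t -> lat_meet (s t) (u j) = 0.
  rewrite /s; elim: t => [_|i t IH].
    by rewrite big_nil; apply: meet_eq0P => //; exact: lat_le_refl.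
  rewrite inE negb_or big_cons => /andP[ji jt].
  by apply: disjointDl => //; [exact: s_ge0|rewrite uD// eq_sym|exact: IH].
elim: r => [_|i r IH /=/andP[ir ur]]; first by rewrite big_nil.
by rewrite big_cons addrC; apply: disjoint_leD => //; [exact: s_disj|exact: IH].
Qed.

(** What disjointness contributes to the splitting of a functional: the modulus
    of a linear combination is at most the sum of the moduli of its terms, which
    are still disjoint, so this sum is no larger than their supremum. *)
Lemma modulus_disjoint_sum_le (I : finType) (x : I -> E) (a : I -> R) w :
  (forall i j, i != j -> lat_meet (modulus (x i)) (modulus (x j)) = 0) ->
  0 <=| w -> (forall i, modulus (a i *: x i) <=| w) ->
  modulus (\sum_i a i *: x i) <=| w.
Proof.
move=> xD w0 aw.
suff : \sum_i `|a i| *: modulus (x i) <=| w.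
  apply: lat_leT.
  apply: (big_ind2 (fun y z => modulus y <=| z)).
  - by rewrite modulus_id; exact: lat_le_refl.
  - by move=> y y' z z' yy zz; apply: (lat_leT (modulusD _ _)); exact: lat_leD.
  - by move=> i _; exact: modulusZ_le.
apply: disjoint_sum_le => //.
- exact: index_enum_uniq.
- move=> i; rewrite -(scaler0 E `|a i|).
  by apply: lat_leZ2l => //; exact: modulus_ge0.
- by move=> i j ij; apply: disjointZ => //; [exact: modulus_ge0..|exact: xD].
- by move=> i; rewrite -modulusZ.
Qed.

End lattice.

(** * Splitting a functional along disjoint vectors *)

Section sup_modulus.
Context {R : realType} {E : banachLatticeType R} {I : finType}.
Implicit Types x y z : I -> E.

(** Starting the supremum from 0 does not change it for nonempty [I], because
    moduli are positive. *)
Definition sup_modulus y : E := \big[lat_join/0]_i modulus (y i).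

Lemma sup_modulusP y w :
  lat_le (sup_modulus y) w <-> lat_le 0 w /\ forall i, lat_le (modulus (y i)) w.
Proof.
rewrite /sup_modulus; split=> [|[w0 yw]]; last first.
  by apply: (big_ind (fun u => lat_le u w)) => // u v uw vw; apply/lat_joinP.
suff key (r : seq I) : lat_le (\big[lat_join/0]_(i <- r) modulus (y i)) w ->
    lat_le 0 w /\ forall i, i \in r -> lat_le (modulus (y i)) w.
  by move/key => -[w0 yw]; split=> // i; exact/yw/mem_index_enum.
elim: r => [|i r IH]; first by rewrite big_nil.
rewrite big_cons => /lat_joinP[yi /IH[w0 yr]]; split=> // j.
by rewrite inE => /predU1P[->|/yr].
Qed.

Lemma sup_modulus_ge0 y : lat_le 0 (sup_modulus y).
Proof. by have /sup_modulusP[] := lat_le_refl (sup_modulus y). Qed.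

Lemma modulus_le_sup y i : lat_le (modulus (y i)) (sup_modulus y).
Proof. by have /sup_modulusP[_] := lat_le_refl (sup_modulus y). Qed.

Lemma sup_modulus_norm_le y (v : E) : (forall i, lat_le (modulus (y i)) (modulus v)) ->
  `|sup_modulus y| <= `|v|.
Proof.
move=> yv; apply: lat_le_norm; rewrite -/(modulus _) modulus_id.
  by apply/sup_modulusP; split; first exact: modulus_ge0.
exact: sup_modulus_ge0.
Qed.

Lemma sublinear_sup_modulus (c : R) : 0 <= c ->
  sublinear (fun y : I -> E => c * `|sup_modulus y|).
Proof.
move=> c0; split=> [y z|a y a0].
  rewrite -mulrDr ler_wpM2l//; apply: le_trans (ler_normD _ _).
  apply: modulus_le_norm; rewrite modulus_id; last exact: sup_modulus_ge0.
  apply/sup_modulusP; split=> [|i].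
    by rewrite -[0]addr0; apply: lat_leD; exact: sup_modulus_ge0.
  by apply: (lat_leT (modulusD _ _)); apply: lat_leD; exact: modulus_le_sup.
rewrite mulrCA ler_wpM2l// -[X in X * _](ger0_norm a0) -normrZ.
apply: modulus_le_norm; rewrite modulus_id; last exact: sup_modulus_ge0.
apply/sup_modulusP; split=> [|i].
  by rewrite -(scaler0 E a); apply: lat_leZ2l => //; exact: sup_modulus_ge0.
by rewrite modulusZ ger0_norm//; apply: lat_leZ2l => //; exact: modulus_le_sup.
Qed.

End sup_modulus.

Lemma dual_sumE {R : realType} {E : normedModType R} (I : finType)
    (h : I -> dual E) (v : E) : (\sum_i h i) v = \sum_i h i v.
Proof. exact: (big_morph (fun k : dual E => k v)). Qed.

(** The linear form [f (\sum_i a i *: x i)] of the vectors [a i *: x i] is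
    dominated by [`|f| * `|sup_modulus y|], by disjointness.  An extension [G] to
    [I -> E] splits along the factors, and the [g i] are its components.  Unlike
    the parts of [f] in disjoint bands they are not unique. *)
Theorem disjoint_functional_split {R : realType} {E : banachLatticeType R}
    (I : finType) (x : I -> E) (f : dual E) :
  (forall i j, i != j -> lat_meet (modulus (x i)) (modulus (x j)) = 0) ->
  exists2 g : I -> dual E, forall i, g i (x i) = f (x i) &
    forall e : I -> R, (forall i, `|e i| <= 1) ->
      `|\sum_i e i *: g i| <= `|f|.
Proof.
move=> xD; pose q (y : I -> E) := `|f| * `|sup_modulus y|.
have sq : sublinear q by exact: sublinear_sup_modulus.
pose D (y : I -> E) (s : R) :=
  exists2 a : I -> R, y = (fun i => a i *: x i) & s = f (\sum_i a i *: x i).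
have cD : dominated_cone q D.
  split.
  - exists (fun=> 0); first by apply/funext => i; rewrite scale0r.
    by rewrite big1 ?linear0// => i _; rewrite scale0r.
  - move=> _ _ _ _ [a -> ->] [b -> ->]; exists (fun i => a i + b i).
      by apply/funext => i; rewrite fctE/= scalerDl.
    by rewrite -linearD -big_split; congr (f _); apply: eq_bigr => i _;
      rewrite scalerDl.
  - move=> c _ _ c0 [a -> ->]; exists (fun i => c * a i).
      by apply/funext => i; rewrite -scalerA.
    rewrite -[LHS]linearZ/= scaler_sumr; congr (f _).
    by apply: eq_bigr => i _; rewrite scalerA.
  - move=> _ _ [a -> ->]; apply: (le_trans (ler_norm _)).
    apply: (le_trans (ler_dual _ _)); rewrite ler_wpM2l//.
    apply: modulus_le_norm; apply: modulus_disjoint_sum_le => // [|i].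
      exact: sup_modulus_ge0.
    exact: (modulus_le_sup (fun i => a i *: x i)).
have [G0 [lG Gq GD]] := mazur_orlicz sq cD.
pose G : {linear (I -> E) -> R} :=
  HB.pack G0 (GRing.isLinear.Build _ _ _ _ G0 lG).
pose single i (v : E) : I -> E := fun j => if j == i then v else 0.
(* A family is the sum of the families supported at one index. *)
have GE y : G y = \sum_i G (single i (y i)).
  rewrite -linear_sum; congr (G _); apply/funext => j.
  rewrite fct_sumE (bigD1 j)//= /single eqxx big1 ?addr0// => i ij.
  by rewrite eq_sym (negbTE ij).
have [g gE] : exists g : I -> dual E, forall i v, g i v = G (single i v).
  suff /choice[g gE] : forall i, exists g : dual E, g =1 G \o single i.
    by exists g => i v; rewrite gE.
  move=> i; have [|||g gE _] := @bounded_linear_dual _ _ (G \o single i) `|f|.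
  - move=> a u v /=; rewrite -[RHS](linearP G); congr (G _); apply/funext => j.
    by rewrite /single !fctE; case: ifP; rewrite // scaler0 addr0.
  - by [].
  - move=> v; apply: (le_trans (Gq _)); rewrite ler_wpM2l//.
    apply: sup_modulus_norm_le => j; rewrite /single; case: ifP => _.
      exact: lat_le_refl.
    by rewrite modulus_id; [exact: modulus_ge0|exact: lat_le_refl].
  - by exists g.
exists g => [i|e e1].
  (* Domination on the line through x i, used below for c = 1 and c = -1. *)
  have ge_f c : c * f (x i) <= c * g i (x i).
    have -> : c * f (x i) = f (c *: x i) by rewrite linearZ.
    have -> : c * g i (x i) = g i (c *: x i) by rewrite linearZ.
    rewrite gE; apply: GD.
    exists (fun j => if j == i then c else 0).
      by apply/funext => j; rewrite /single; case: eqP => [->|_];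
        rewrite ?scale0r.
    rewrite (bigD1 i)//= eqxx big1 ?addr0// => j /negbTE->.
    by rewrite scale0r.
  by apply/eqP; rewrite eq_le; move: (ge_f 1) (ge_f (-1)); lra.
apply: dual_norm_le_one_sided => // v; rewrite dual_sumE.
have -> : \sum_i (e i *: g i) v = G (fun i => e i *: v).
  rewrite GE; apply: eq_bigr => i _; rewrite -gE.
  by rewrite linearZ.
apply: (le_trans (Gq _)); rewrite ler_wpM2l//.
apply: sup_modulus_norm_le => i; rewrite modulusZ.
rewrite -[X in lat_le _ X]scale1r -lat_subr_ge0 -scalerBl.
rewrite -(scaler0 E (1 - `|e i|)).
by apply: lat_leZ2l; rewrite ?subr_ge0//; exact: modulus_ge0.
Qed.

Section cotype.
Context {R : realType}.

(** The integral of a nonnegative function is the supremum of the integrals of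
    the simple functions below it.  It is therefore monotone even on
    non-measurable functions, and the bound can be used for the norms of
    Rademacher sums without any measurability argument. *)
Lemma Rintegral01_le (h : R -> R) (c : R) : (forall t, 0 <= h t <= c) ->
  \int[lebesgue_measure]_(t in `[0, 1]) h t <= c.
Proof.
move=> hc; have c0 : 0 <= c by have /andP[] := hc 0; exact: le_trans.
pose mu := @lebesgue_measure R; pose U : set R := `[0, 1]%classic.
have int_ge0 : (0 <= \int[mu]_(t in U) (h t)%:E)%E.
  by apply: integral_ge0 => t _; rewrite lee_fin; case/andP: (hc t).
have int_le : (\int[mu]_(t in U) (h t)%:E <= c%:E)%E.
  have <- : (\int[mu]_(t in U) (cst c%:E) t = c%:E)%E.
    have muU : mu U = 1%E.
      by rewrite /mu /U lebesgue_measure_itv/= lte_fin ltr01 sube0.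
    rewrite integral_cst; last exact: measurable_itv.
    exact: etrans (congr1 (mule c%:E) muU) (mule1 _).
  rewrite !ge0_integralE; last 2 first.
  - by move=> t _; rewrite lee_fin.
  - by move=> t _; rewrite lee_fin; case/andP: (hc t).
  apply: ereal_sup_le => _ [k kh <-]; exists k => // t.
  apply: (le_trans (kh t)); rewrite /patch; case: ifP => // _.
  by rewrite lee_fin; case/andP: (hc t).
rewrite /Rintegral -lee_fin fineK// ge0_fin_numE//.
exact: le_lt_trans int_le (ltry _).
Qed.

Lemma normr_rademacher_le1 (k : nat) (t : R) : `|rademacher k t| <= 1.
Proof. by rewrite /rademacher normr_sg; case: eqP. Qed.

(** A bound for all coefficients in [[-1, 1]] bounds the integrand of the
    Rademacher average at every point; the value 0 of the Rademacher functions
    at dyadic points is covered too. *)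
Lemma cotype_unconditional_sum (p : R) (Z : normedModType R) : cotype p Z ->
  exists2 C : R, 0 < C & forall (n : nat) (g : 'I_n -> Z) (b : R), 0 <= b ->
    (forall e : 'I_n -> R, (forall i, `|e i| <= 1) ->
      `|\sum_i e i *: g i| <= b) ->
    \sum_i `|g i| `^ p <= (C * b) `^ p.
Proof.
move=> [p2 [C C0 HC]]; exists C => // n g b b0 gb.
have p0 : 0 < p by exact: lt_le_trans p2.
have S0 : 0 <= \sum_i `|g i| `^ p by apply: sumr_ge0 => i _; exact: powR_ge0.
rewrite -[leLHS]powRr1// -(mulVf (lt0r_neq0 p0)) powRrM.
apply: ge0_ler_powR; rewrite ?nnegrE ?powR_ge0 ?mulr_ge0 ?(ltW p0) ?(ltW C0)//.
apply: (le_trans (HC n g)); rewrite ler_wpM2l ?(ltW C0)//.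
have -> : b = (b ^+ 2) `^ 2^-1.
  by rewrite powR12_sqrt ?exprn_ge0// sqrtr_sqr ger0_norm.
apply: ge0_ler_powR; rewrite ?invr_ge0//.
- by rewrite nnegrE Rintegral_ge0// => t _; rewrite exprn_ge0.
- by rewrite nnegrE exprn_ge0.
apply: Rintegral01_le => t; rewrite exprn_ge0//=.
rewrite ler_pXn2r ?nnegrE//; apply: gb => i; exact: normr_rademacher_le1.
Qed.

(** Splitting [f] along the first [n] vectors bounds the partial sums of
    [`|f (x k)| ^ p] independently of [n]. *)
Theorem dual_cotype_disjoint_property (p : R) (E : banachLatticeType R) :
  cotype p (dual E) -> disjoint_property p E.
Proof.
move=> cE x [M xM] xD f.
have M0 : 0 <= M by exact: le_trans (xM 0%N).
have p0 : 0 < p by case: cE => p2 _; exact: lt_le_trans p2.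
have [C C0 HC] := cotype_unconditional_sum cE.
apply: nondecreasing_is_cvgn.
  apply/nondecreasing_seqP => n; rewrite -subr_ge0 seriesSB.
  exact: powR_ge0.
exists (M `^ p * (C * `|f|) `^ p) => _ [n _ <-].
have [|g gf g_le] := @disjoint_functional_split _ _ _ (fun i : 'I_n => x i) f.
  by move=> i j ij; exact: xD.
rewrite /series/= big_mkord; apply: (@le_trans _ _ (M `^ p * \sum_i `|g i| `^ p)).
  rewrite mulr_sumr ler_sum// => i _; rewrite -powRM// -gf.
  apply: ge0_ler_powR; rewrite ?nnegrE ?mulr_ge0 ?(ltW p0)//.
  by apply: (le_trans (ler_dual _ _)); rewrite mulrC ler_wpM2r.
by rewrite ler_wpM2l ?powR_ge0//; exact: HC.
Qed.

End cotype.

(** * Disjoint p-convergent operators *)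

Lemma weakly_p_summable_null {R : realType} (p : R) (Z : normedModType R)
    (x : nat -> Z) : 0 < p -> weakly_p_summable p x -> weakly_null x.
Proof.
move=> p0 xs f; apply/cvgr0Pnorm_lt => e e0.
have /cvgr0Pnorm_lt/(_ _ (powR_gt0 p e0)) := cvg_series_cvg_0 (xs f).
apply: filterS => n; rewrite ger0_norm ?powR_ge0// => fe.
rewrite ltNge; apply/negP => ef; move: fe; rewrite ltNge => /negP; apply.
by apply: ge0_ler_powR; rewrite ?nnegrE ?(ltW p0) ?(ltW e0).
Qed.

Theorem theorem2p7 (R : realType) (p : R) (E : banachLatticeType R)
    (X : completeNormedModType R) (T : {linear E -> X}) :
  1 <= p ->
  cotype p (dual E) \/ disjoint_property p E ->
  continuous T ->
  (disjoint_p_convergent p T <-> almost_Dunford_Pettis T).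
Proof.
move=> p1 hE _; split=> hT x xD xw; apply: hT => //.
  have dE : disjoint_property p E.
    by case: hE => // /dual_cotype_disjoint_property.
  exact: dE (weakly_null_bounded xw) xD.
by apply: weakly_p_summable_null xw; exact: lt_le_trans p1.
Qed.
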